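(* Let $V$ be a $d$-dimensional vector space over the field of order $q$, let $T$ be the translation group of $V$, let $H$ be a subgroup of $\mathrm{GL}(d,q)=\mathrm{GL}(V)$, and let $G=T\rtimes H$, regarded as a transitive permutation group on $V$. Then $D(G)=T\rtimes R(H)$, and so $|G:D(G)|=|H:R(H)|$ and $G/D(G)\cong H/R(H)$.
   Context: Here $q$ is a prime power and $d\geqslant1$. $D(G)$ denotes the subgroup of $G$ generated by the derangements in $G$, i.e. the elements of $G$ with no fixed points on $V$. $R(H)$ denotes the subgroup of $H$ generated by the elements of $H$ which have an eigenvalue $1$ in their action on $V$ (equivalently, which fix some non-zero vector of $V$). *)

(* Defs.v *)
From mathcomp Require Import all_boot all_order all_algebra all_fingroup.
From mathcomp Require Import all_solvable all_field all_character.

Set Implicit Arguments.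
Unset Strict Implicit.
Unset Printing Implicit Defensive.

Import GRing.Theory GroupScope.

(* The dimension is written d.+1 throughout, since 'GL_n[F] is a matrix group *)
(* of size n only for n >= 1. Vectors are rows and matrices act on the right. *)

Section DerangementSubgroup.

Variables (T : finType) (G : {set {perm T}}).

Definition derangements : {set {perm T}} := [set g in G | [forall x, g x != x]].

Definition derangement_group : {group {perm T}} := <<derangements>>%G.

End DerangementSubgroup.

Section AffineGroups.

Variables (F : finFieldType) (d : nat).

Definition fixing_group (H : {set {'GL_d.+1[F]}}) : {group {'GL_d.+1[F]}} :=
  <<[set h in H | eigenvalue (GLval h) 1%R]>>%G.

(* The library's regular action 'R, for the additive group of row vectors. *)
Definition translations : {group {perm 'rV[F]_d.+1}} :=
  (actperm 'R @* [set: 'rV[F]_d.+1])%G.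

Definition GLperm : {morphism [set: {'GL_d.+1[F]}] >-> {perm 'rV[F]_d.+1}} :=
  actperm ('MR (GLrepr F d)).

Lemma translationE v (x : 'rV[F]_d.+1) : actperm 'R v x = (x + v)%R.
Proof. by rewrite actpermE. Qed.

Lemma GLpermE h (x : 'rV[F]_d.+1) : GLperm h x = (x *m GLval h)%R.
Proof. by rewrite actpermE /= mx_repr_actE ?inE. Qed.

Lemma GLperm_inj : 'injm GLperm.
Proof.
apply/injmP=> h k _ _ eq_hk; apply: val_inj; apply/row_matrixP=> i.
by rewrite !rowE -!GLpermE eq_hk.
Qed.

Lemma translationsP (g : {perm 'rV[F]_d.+1}) :
  reflect (exists v, forall x, g x = x + v)%R (g \in translations).
Proof.
apply: (iffP morphimP) => [[v _ _ ->]|[v gE]].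
  by exists v => x; rewrite translationE.
by exists v; rewrite ?inE //; apply/permP=> x; rewrite gE translationE.
Qed.

Lemma affine_sdprod (H : {group {'GL_d.+1[F]}}) :
  translations ><| (GLperm @* H) = translations <*> (GLperm @* H).
Proof.
have nTH : GLperm @* H \subset 'N(translations).
  apply/subsetP=> _ /morphimP[h _ _ ->]; rewrite inE.
  apply/subsetP=> _ /imsetP[g /translationsP[v gE] ->].
  apply/translationsP; exists (v *m GLval h)%R => x.
  rewrite -{1}(permKV (GLperm h) x) permJ gE GLpermE mulmxDl -GLpermE.
  by rewrite permKV.
rewrite sdprodEY //; apply/trivgP/subsetP=> g /setIP[/translationsP[v gE]].
case/morphimP=> h _ _ gh; rewrite inE; apply/eqP/permP=> x; rewrite gE perm1.
by have := gE 0%R; rewrite gh GLpermE mul0mx add0r => <-; rewrite addr0.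
Qed.

Lemma affine_transitive (H : {group {'GL_d.+1[F]}})
    (G : {group {perm 'rV[F]_d.+1}}) :
  translations ><| (GLperm @* H) = G -> [transitive G, on setT | 'P].
Proof.
case/sdprod_context=> /andP[sTG _] _ _ _ _.
apply/imsetP; exists 0%R; rewrite ?inE //; apply/setP=> v; rewrite inE.
apply/esym/orbitP; exists (actperm 'R v).
  by apply: (subsetP sTG); apply: mem_morphim; rewrite ?inE.
by rewrite /= /aperm translationE add0r.
Qed.

End AffineGroups.

(* Main.v *)
(* Write an element of G as x |-> x h + v.  It fixes x exactly when
   x (h - 1) = - v, so it can only be a derangement if h - 1 is singular, that
   is, if h has eigenvalue 1; and if h - 1 is singular, then some v lies outside
   its image and gives a derangement.  As non-trivial translations are
   derangements, D(G) contains T, hence also every such h. *)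

Require Import Defs.
From mathcomp Require Import all_boot all_order all_algebra all_fingroup.
From mathcomp Require Import all_solvable all_field all_character.
Import GRing.Theory GroupScope.

(** The permutation [k] carries the fixed points of [g] onto those of [g ^ k]; this gives normality
    of the derangement subgroup. *)
Lemma derangementsJ (T : finType) (G : {group {perm T}}) (g k : {perm T}) :
  k \in G -> g \in derangements G -> g ^ k \in derangements G.
Proof.
move=> kG; rewrite !inE => /andP[gG /forallP dg]; rewrite groupJ //=.
apply/forallP=> x; rewrite -(permKV k x) permJ (inj_eq perm_inj).
exact: dg.
Qed.

Lemma derangement_group_normal (T : finType) (G : {group {perm T}}) :
  derangement_group G <| G.
Proof.
rewrite /normal gen_subG; apply/andP; split.
  by apply/subsetP=> g; rewrite inE => /andP[].
apply: norms_gen; apply/subsetP=> k kG; rewrite inE.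
by apply/subsetP=> _ /imsetP[g gD ->]; apply: derangementsJ.
Qed.

Section Affine.

Variables (F : finFieldType) (d : nat).
Implicit Types (H : {group {'GL_d.+1[F]}}) (h k : {'GL_d.+1[F]}).

(** If [h] fixes a non-zero row [x], then [h ^ k] fixes the image of [x] under [k], which is
    non-zero since [k] is injective and sends 0 to 0. *)
Lemma eigenvalue1J h k :
  eigenvalue (GLval h) 1%R -> eigenvalue (GLval (h ^ k)) 1%R.
Proof.
case/eigenvalueP=> x; rewrite scale1r -GLpermE => hx x0.
apply/eigenvalueP; exists (GLperm F d k x).
  by rewrite scale1r -GLpermE morphJ ?inE // permJ hx.
by rewrite -[0%R](mul0mx 1 (GLval k)) -GLpermE (inj_eq perm_inj).
Qed.

Lemma fixing_group_normal H : fixing_group H <| H.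
Proof.
rewrite /normal gen_subG; apply/andP; split.
  by apply/subsetP=> h; rewrite inE => /andP[].
apply: norms_gen; apply/subsetP=> k kH; rewrite inE.
apply/subsetP=> _ /imsetP[h /[!inE] /andP[hH h1] ->].
by rewrite groupJ // eigenvalue1J.
Qed.

Lemma affine_fixpoint h (v : 'rV[F]_d.+1) :
  ~~ eigenvalue (GLval h) 1%R -> exists x, (x *m GLval h + v = x)%R.
Proof.
rewrite /eigenvalue /eigenspace negbK kermx_eq0 row_free_unit => hU.
pose x := (- v *m invmx (GLval h - 1%:M))%R; exists x.
have: (x *m (GLval h - 1%:M) = - v)%R by exact: mulmxKV.
by rewrite mulmxBr mulmx1 => /eqP; rewrite subr_eq addrC => /eqP->; rewrite subrK.
Qed.

Lemma affine_fixpoint_free h : eigenvalue (GLval h) 1%R ->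
  exists v : 'rV[F]_d.+1, forall x, (x *m GLval h + v != x)%R.
Proof.
rewrite /eigenvalue /eigenspace kermx_eq0 row_free_unit -row_full_unit -sub1mx.
(* As [h - 1] is not of full rank, its row space misses some standard basis row, which serves as
   [v]. A fixed point [x] would give [v = (- x) (h - 1)], inside that row space. *)
case/row_subPn=> i iN; exists (row i 1%:M) => x; apply: contra iN => /eqP xE.
apply/submxP; exists (- x)%R.
by rewrite mulNmx mulmxBr mulmx1 opprB -{1}xE [(_ + row _ _)%R]addrC addrK.
Qed.

Section DerangementGroup.

Variables (H : {group {'GL_d.+1[F]}}) (G : {group {perm 'rV[F]_d.+1}}).
Hypothesis defG : translations F d ><| (GLperm F d @* H) = G.

Lemma translations_sub_derangement_group :
  translations F d \subset derangement_group G.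
Proof.
have /andP[sTG _] : translations F d <| G by case/sdprod_context: defG.
apply/subsetP=> t tT; have /translationsP[v tE] := tT.
have [v0|v0] := eqVneq v 0%R.
  by rewrite (_ : t = 1) //; apply/permP=> x; rewrite tE v0 addr0 perm1.
apply: mem_gen; rewrite inE (subsetP sTG) //=; apply/forallP=> x.
by rewrite tE -subr_eq0 addrC addKr.
Qed.

Lemma fixing_group_sub_derangement_group :
  GLperm F d @* fixing_group H \subset derangement_group G.
Proof.
have [/andP[sTG _] sHG _ _ _] := sdprod_context defG.
rewrite morphim_gen ?subsetT // gen_subG.
apply/subsetP=> _ /morphimP[h _ /[!inE] /andP[hH /affine_fixpoint_free[v vP]] ->].
have tT : actperm 'R v \in translations F d by rewrite mem_morphim ?inE.
(* The translation by [v] already lies in the derangement subgroup, so membership of [h] is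
   equivalent to that of the product, [h] first and then the translation, which is the derangement
   [x |-> x h + v]. *)
rewrite -(groupMr _ (subsetP translations_sub_derangement_group _ tT)).
apply: mem_gen; rewrite inE groupM ?(subsetP sTG _ tT) //=; last first.
  by rewrite (subsetP sHG) ?mem_morphim ?inE.
by apply/forallP=> x; rewrite permM translationE GLpermE.
Qed.

Lemma derangement_group_sdprod :
  translations F d ><| (GLperm F d @* fixing_group H) = derangement_group G.
Proof.
rewrite (affine_sdprod (fixing_group H)); apply/eqP; rewrite eqEsubset.
rewrite join_subG translations_sub_derangement_group.
rewrite fixing_group_sub_derangement_group /= gen_subG.
have [_ defTH _ _] := sdprodP defG.
apply/subsetP=> g; rewrite inE -defTH => /andP[/mulsgP[t k tT kH ->] /forallP].
case/morphimP: kH => h _ hH -> dg.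
rewrite groupM ?(subsetP (joing_subl _ _) _ tT) //.
apply: (subsetP (joing_subr _ _)); rewrite mem_morphim ?inE //.
apply: mem_gen; rewrite inE hH /=; apply: contraT => h1.
have /translationsP[v tE] := tT.
(* Here the translation acts before [h]: [(x + v) h = x h + v h], so the constant term is [v h]. *)
have [x xE] := affine_fixpoint h (v *m GLval h)%R h1.
by case/eqP: (dg x); rewrite permM tE GLpermE mulmxDl xE.
Qed.

(** The second isomorphism theorem applied to the image of [H]: together with D(G) it generates G,
    and it meets D(G) in the image of R(H). *)
Lemma derangement_group_isog :
  (G / derangement_group G) \isog (H / fixing_group H).
Proof.
have [_ sHG defTH _ tiTH] := sdprod_context defG.
have [_ defTR _ _] := sdprodP derangement_group_sdprod.
have /andP[sDG nDG] := derangement_group_normal _ G.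
have sRH := normal_sub (fixing_group_normal H).
have nDH := subset_trans sHG nDG.
have defDH : derangement_group G * GLperm F d @* H = G.
  apply/eqP; rewrite eqEsubset mul_subG //= -{1}defTH.
  by rewrite mulSg ?translations_sub_derangement_group.
have -> : G / derangement_group G = (GLperm F d @* H) / derangement_group G.
  by rewrite -[RHS]quotientMidl defDH.
have tiDH :
  derangement_group G :&: GLperm F d @* H = GLperm F d @* fixing_group H.
  (* Dedekind's modular law: R(H) lies in H, so the intersection of H with T R(H) is the product of
     the trivial group H :&: T with R(H). *)
  by rewrite setIC -defTR -group_modr ?morphimS // [_ :&: _]setIC tiTH mul1g.
rewrite isog_sym; apply: isog_trans (second_isog nDH); rewrite tiDH.
(* R(H) is only known to be normal in [H], so the embedding is restricted to [H] before it is passed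
   to quotients; the induced map stays injective. *)
pose f := restrm_morphism (subsetT H) (GLperm F d).
have fE (A : {set {'GL_d.+1[F]}}) : A \subset H -> f @* A = GLperm F d @* A.
  by move=> sAH; rewrite morphim_restrm (setIidPr sAH).
have injf : 'injm f by rewrite injm_restrm ?GLperm_inj.
rewrite /= -(fE _ sRH) -(fE H) // -(morphim_quotm f (fixing_group_normal H)).
exact: sub_isog (subxx _) (injm_quotm _ injf).
Qed.

End DerangementGroup.
End Affine.

Theorem proposition3p1 (F : finFieldType) (d : nat) (H : {group {'GL_d.+1[F]}})
    (G : {group {perm 'rV[F]_d.+1}})
    (defG : translations F d ><| (GLperm F d @* H) = G) :
  [/\ translations F d ><| (GLperm F d @* fixing_group H)
        = derangement_group G,
      #|G : derangement_group G| = #|H : fixing_group H|,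
      derangement_group G <| G,
      fixing_group H <| H
    & (G / derangement_group G) \isog (H / fixing_group H)].
Proof.
have nsDG := derangement_group_normal _ G; have nsRH := fixing_group_normal _ _ H.
have isoGH := derangement_group_isog _ _ _ _ defG.
split=> //; first exact: derangement_group_sdprod.
by rewrite -!card_quotient ?normal_norm // (card_isog isoGH).
Qed.
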